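(* Let $\mathfrak V$ be a variety of algebras over a field $\mathbf F$. Then $\mathfrak V$ is nilpotent if and only if for every algebra $A\in\mathfrak V$, every subalgebra $B$ of $A$ is a subideal of $A$.
   Context: An algebra over a field $\mathbf F$ is a vector space over $\mathbf F$ with a bilinear multiplication (not assumed associative, commutative or unital). A variety of $\mathbf F$-algebras is the class of all $\mathbf F$-algebras satisfying a given set of polynomial identities $v(x_1,\dots,x_n)=0$, where each $v$ is a nonassociative polynomial over $\mathbf F$ without constant term. For an algebra $A$, put $A^1=A$ and $A^k=\sum_{s+t=k}A^sA^t$, where $LM$ denotes the linear span of all products $lm$, $l\in L$, $m\in M$. $A$ is nilpotent if $A^{c+1}=\{0\}$ for some $c\ge 1$. A variety is nilpotent if every algebra in it is nilpotent. An ideal means a two-sided ideal. A subalgebra $B$ of $A$ is a subideal of $A$ if there is a finite series of subalgebras $B=B_0\subset B_1\subset\dots\subset B_s=A$ such that $B_{i-1}$ is an ideal of $B_i$ for all $i=1,\dots,s$. *)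

(* Defs.v *)
From mathcomp Require Import all_boot all_order all_algebra.
From mathcomp Require Import boolp classical_sets.

Set Implicit Arguments.
Unset Strict Implicit.
Unset Printing Implicit Defensive.

Import GRing.Theory.

Local Open Scope classical_set_scope.
Local Open Scope ring_scope.

(* Not assumed associative, commutative or unital. *)
Record nalg (F : fieldType) := NAlg {
  nalg_sort :> lmodType F;
  nmul : {bilinear nalg_sort -> nalg_sort -> nalg_sort}
}.

Inductive monomial :=
| MVar of nat
| MMul of monomial & monomial.

(* A formal linear combination of monomials. Monomials have degree at least 1,
   so there is no constant term. A monomial may occur several times in the
   list, in which case its coefficients add up. *)
Definition napoly (F : fieldType) := seq (F * monomial).

Section Algebra.
Variables (F : fieldType) (A : nalg F).
Implicit Types (L M B C I : set A) (x y : A).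

Fixpoint meval (e : nat -> A) (m : monomial) : A :=
  match m with
  | MVar i => e i
  | MMul m1 m2 => nmul A (meval e m1) (meval e m2)
  end.

Definition peval (e : nat -> A) (v : napoly F) : A :=
  \sum_(cm <- v) cm.1 *: meval e cm.2.

Definition satisfies (v : napoly F) : Prop :=
  forall e : nat -> A, peval e v = 0.

Definition subspace L : Prop := submod_closed [in L].

Definition lspan (X : set A) : set A := smallest subspace X.

Definition smul L M : set A :=
  lspan [set z | exists2 l, L l & exists2 m, M m & z = nmul A l m].

(* The sum of the subspaces [P s * P t] over all s, t >= 1 with s + t = k. *)
Definition sum_smul (P : nat -> set A) (k : nat) : set A :=
  lspan (\bigcup_(st in [set st : nat * nat |
                          [/\ (0 < st.1)%N, (0 < st.2)%N
                            & (st.1 + st.2)%N = k]])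
           smul (P st.1) (P st.2)).

(* [n] only bounds the depth of the recursion: [npow_rec n k] is the k-th power
   as soon as k <= n. *)
Fixpoint npow_rec (n k : nat) : set A :=
  if n is n'.+1 then
    if (k <= 1)%N then setT else sum_smul (npow_rec n') k
  else setT.

(* The powers are indexed from 1; the value at 0 is irrelevant. *)
Definition npow (k : nat) : set A := npow_rec k k.

Lemma npow_rec_stable n k : (k <= n)%N -> npow_rec n k = npow k.
Proof.
rewrite /npow; elim/ltn_ind: k n => k IH [|n].
  by rewrite leqn0 => /eqP ->.
case: k IH => [|[|k]] IH // lekn.
rewrite -[LHS]/(sum_smul (npow_rec n) k.+2).
rewrite -[RHS]/(sum_smul (npow_rec k.+1) k.+2).
rewrite /sum_smul; congr lspan.
apply: eq_bigcupr => -[s t] [s0 t0 stk].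
rewrite ![(_, _).1]/= ![(_, _).2]/= in s0 t0 stk *.
have sk : (s < k.+2)%N by rewrite -stk -addn1 leq_add2l.
have tk : (t < k.+2)%N by rewrite -stk -add1n leq_add2r.
have sn : (s <= n)%N by rewrite -ltnS; exact: leq_trans sk lekn.
have tn : (t <= n)%N by rewrite -ltnS; exact: leq_trans tk lekn.
by rewrite (IH s sk _ sn) (IH t tk _ tn) (IH s sk k.+1 sk) (IH t tk k.+1 tk).
Qed.

Lemma npow1 : npow 1 = setT.
Proof. by []. Qed.

Lemma npowE k : (1 < k)%N -> npow k = sum_smul npow k.
Proof.
case: k => [|[|k]] // _.
rewrite -[LHS]/(sum_smul (npow_rec k.+1) k.+2) /sum_smul; congr lspan.
apply: eq_bigcupr => -[s t] [s0 t0 stk].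
rewrite ![(_, _).1]/= ![(_, _).2]/= in s0 t0 stk *.
have sk : (s < k.+2)%N by rewrite -stk -addn1 leq_add2l.
have tk : (t < k.+2)%N by rewrite -stk -add1n leq_add2r.
by rewrite !npow_rec_stable.
Qed.

Definition nilpotent_nalg : Prop :=
  exists2 c : nat, (1 <= c)%N & npow c.+1 = [set 0].

Definition subalgebra B : Prop :=
  subspace B /\ forall x y, B x -> B y -> B (nmul A x y).

Definition ideal_of I B : Prop :=
  [/\ subspace I, I `<=` B &
      forall x y, I x -> B y -> I (nmul A x y) /\ I (nmul A y x)].

Definition subideal B : Prop :=
  exists (s : nat) (C : nat -> set A),
    [/\ C 0%N = B,
        C s = setT,
        forall i, (i <= s)%N -> subalgebra (C i) &
        forall i, (i < s)%N -> ideal_of (C i) (C i.+1)].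

End Algebra.

Definition variety (F : fieldType) (V : nalg F -> Prop) : Prop :=
  exists E : set (napoly F),
    forall A : nalg F, V A <-> (forall v, E v -> satisfies A v).

Definition nilpotent_variety (F : fieldType) (V : nalg F -> Prop) : Prop :=
  forall A : nalg F, V A -> nilpotent_nalg A.

(* Main.v *)
Require Import Defs.
From HB Require Import structures.
From mathcomp Require Import all_boot all_order all_algebra.
From mathcomp Require Import boolp classical_sets.

(** If [A] is nilpotent of class [c] and [B] is a subalgebra, then the series
    [B + A^(c+1-i)] exhibits [B] as a subideal.

    Conversely, let [A] be in the variety; then so is [A * A], whose diagonal is
    a subideal, of depth [s] say. Multiplying [(a, 0)] by diagonal elements
    [(b, b)] on either side [s] times lands in the diagonal, so every product of
    [s] left or right multiplications vanishes on [A]. A nonassociative monomial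
    with at least [2^s] factors has a branch of depth at least [s], hence is such
    a product; therefore [A^(2^s) = 0]. *)

Set Implicit Arguments.
Unset Strict Implicit.
Unset Printing Implicit Defensive.

Import GRing.Theory.

Local Open Scope classical_set_scope.
Local Open Scope ring_scope.

Section Powers.
Variables (F : fieldType) (A : nalg F).
Implicit Types (L B X : set A) (x y : A).

Lemma subspaceP L :
  subspace L <-> L 0 /\ forall a x y, L x -> L y -> L (a *: x + y).
Proof.
split=> [[L0 LP]|[L0 LP]].
  split=> [|a x y Lx Ly]; first exact/set_mem/L0.
  by apply/set_mem/LP; exact/mem_set.
split=> [|a x y /set_mem Lx /set_mem Ly]; first exact/mem_set.
exact/mem_set/LP.
Qed.

Lemma subspaceT : subspace [set: A].
Proof. exact/subspaceP. Qed.

Lemma lspan_subspace X : subspace (lspan X).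
Proof.
apply/subspaceP; split=> [L [/subspaceP[]]//|a x y Xx Xy L LP].
by have [/subspaceP[_ +] _] := LP; apply; [exact: Xx|exact: Xy].
Qed.

Lemma npow_subspace k : subspace (@npow F A k).
Proof.
by case: k => [|[|k]]; [exact: subspaceT..|rewrite npowE //; exact: lspan_subspace].
Qed.

Lemma npow_mul s t x y : (0 < s)%N -> (0 < t)%N ->
  npow s x -> npow t y -> npow (s + t) (nmul A x y).
Proof.
move=> s0 t0 sx ty; rewrite npowE; last by rewrite -[2%N]/(1 + 1)%N leq_add.
apply: sub_gen_smallest; exists (s, t) => //=.
by apply: sub_gen_smallest; exists x => //; exists y.
Qed.

(** Elimination rule for powers: it flattens the two nested spans of the definition, so that
    inclusions need only be tested on single products. *)
Lemma npow_min k L : (1 < k)%N -> subspace L ->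
  (forall s t x y, (0 < s)%N -> (0 < t)%N -> (s + t)%N = k ->
     npow s x -> npow t y -> L (nmul A x y)) ->
  npow k `<=` L.
Proof.
move=> k1 sL H; rewrite npowE //; apply: smallest_sub => // z [[s t]] /=.
move=> [s0 t0 stk]; apply: (smallest_sub sL) => {z} _ [x sx [y ty ->]].
exact: (H s t).
Qed.

(** In a product of total degree at least 3 some factor has degree at least 2; by induction that
    factor also lies in the power one degree lower. *)
Lemma npowS k : npow k.+1 `<=` @npow F A k.
Proof.
elim/ltn_ind: k => -[|[|k]] IH //.
apply: npow_min => //; first exact: npow_subspace.
move=> [|[|s]] t x y // _ t0 stk sx ty.
  have {stk} tk : t = k.+2 by case: stk.
  rewrite -[k.+2]/(1 + k.+1)%N; apply: npow_mul => //.
  by apply: IH => //; rewrite -tk.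
have stk2 : (s.+1 + t)%N = k.+2 by apply: succn_inj.
rewrite -stk2; apply: npow_mul => //; apply: IH => //.
by rewrite -stk2 addSn ltnS -[s.+1]addn1 leq_add2l.
Qed.

Lemma npow_mulr k x y : npow k x -> npow k.+1 (nmul A x y).
Proof. by case: k => // k kx; rewrite -addn1; exact: npow_mul. Qed.

Lemma npow_mull k x y : npow k y -> npow k.+1 (nmul A x y).
Proof. by case: k => // k ky; rewrite -add1n; exact: npow_mul. Qed.

Lemma npow_zero_nilpotent c : (0 < c)%N -> npow c.+1 `<=` [set (0 : A)] ->
  nilpotent_nalg A.
Proof.
move=> c0 c1; exists c => //; apply/seteqP; split=> // _ ->.
by have /subspaceP[] := npow_subspace c.+1.
Qed.

(** This is [B + A^k], phrased as congruence modulo [A^k] to an element of [B]. *)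
Definition npow_ext B k : set A := [set z | exists2 b, B b & npow k (z - b)].

Lemma npow_ext_subspace B k : subspace B -> subspace (npow_ext B k).
Proof.
move=> /subspaceP[B0 BP]; have /subspaceP[P0 PP] := npow_subspace k.
apply/subspaceP; split=> [|a x y [b Bb xb] [b' Bb' yb']].
  by exists 0; rewrite ?subr0.
exists (a *: b + b'); first exact: BP.
by rewrite opprD addrACA -scalerBr; exact: PP.
Qed.

(** Write [xy - bb'] as [(x - b)y + b(y - b')]: each product raises the degree by one, so the
    summands lie in [A^(k+2)] and [A^(k+1)]. The other side is symmetric. *)
Lemma npow_ext_mul B k x y : subalgebra B ->
  npow_ext B k.+1 x -> npow_ext B k y ->
  npow_ext B k.+1 (nmul A x y) /\ npow_ext B k.+1 (nmul A y x).
Proof.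
move=> [_ BM] [b Bb xb] [b' Bb' yb'].
have PD u v : npow k.+1 u -> npow k.+1 v -> npow k.+1 (u + v : A).
  move=> ku kv; have /subspaceP[_ PP] := npow_subspace k.+1.
  by rewrite -[u]scale1r; exact: PP.
split; [exists (nmul A b b')|exists (nmul A b' b)]; try exact: BM.
  have -> : nmul A x y - nmul A b b' =
    nmul A (x - b) y + nmul A b (y - b') :> A.
    by rewrite linearBl linearBr addrA subrK.
  by apply: PD; [exact/npowS/npow_mulr|exact: npow_mull].
have -> : nmul A y x - nmul A b' b =
  nmul A y (x - b) + nmul A (y - b') b :> A.
  by rewrite linearBl linearBr addrA subrK.
by apply: PD; [exact/npowS/npow_mull|exact: npow_mulr].
Qed.

Lemma npow_extS B k : npow_ext B k.+1 `<=` npow_ext B k.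
Proof. by move=> x [b Bb xb]; exists b => //; exact: npowS. Qed.

Lemma nilpotent_subideal B : nilpotent_nalg A -> subalgebra B -> subideal B.
Proof.
move=> [c c1 Ac] Balg; have [Bsub _] := Balg.
(* The index runs from [c + 1], where the added power is zero, down to 1, where it is all of [A]. *)
exists c, (fun i => npow_ext B (c.+1 - i)); split.
- rewrite subn0; apply/seteqP; split=> [x [b Bb]|b Bb].
    by rewrite Ac => /subr0_eq ->.
  by exists b => //; rewrite subrr Ac.
- rewrite subSnn; apply/seteqP; split=> // x _.
  by have /subspaceP[B0 _] := Bsub; exists 0.
- move=> i ic; rewrite subSn //; split=> [|x y Bx By].
    exact: npow_ext_subspace.
  by have [] := npow_ext_mul Balg Bx (npow_extS By).
- move=> i ic; rewrite subSS subSn ?(ltnW ic) //; split.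
  + exact: npow_ext_subspace.
  + exact: npow_extS.
  + by move=> x y; exact: npow_ext_mul.
Qed.

(* Of two factors whose degrees add up to at least [2^(k+1)], one has degree at
   least [2^k]. *)
Lemma npow_exp2_sub (D : nat -> set A) : D 0%N = setT ->
  (forall k, subspace (D k)) ->
  (forall k x y, D k x -> D k.+1 (nmul A x y) /\ D k.+1 (nmul A y x)) ->
  forall k n, (2 ^ k <= n)%N -> npow n `<=` D k.
Proof.
move=> D0 Dsub DM; elim=> [|k IH] n kn; first by rewrite D0.
have k0 : (0 < 2 ^ k)%N by rewrite expn_gt0.
apply: npow_min => //.
  by apply: leq_trans kn; rewrite -[2%N]/(2 ^ 1)%N leq_exp2l.
move=> s t x y s0 t0 stn sx ty.
have [ks|sk] := leqP (2 ^ k) s.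
  by have [] := DM k x y (IH s ks x sx).
suff kt : (2 ^ k <= t)%N by have [] := DM k y x (IH t kt y ty).
rewrite -(leq_add2l (2 ^ k)) addnn -mul2n -expnS (leq_trans kn) // -stn.
by rewrite leq_add2r ltnW.
Qed.

End Powers.

Section Square.
Variables (F : fieldType) (A : nalg F).

Definition sq_mul (x y : A * A) : A * A := (nmul A x.1 y.1, nmul A x.2 y.2).

Lemma sq_mul_bilinear : bilinear_for
  (GRing.Scale.Law.clone _ _ *:%R _) (GRing.Scale.Law.clone _ _ *:%R _) sq_mul.
Proof.
split=> [u'|u] a x y; rewrite /sq_mul /=; congr pair => /=.
- exact: linearPl.
- exact: linearPl.
- exact: linearPr.
- exact: linearPr.
Qed.

HB.instance Definition _ := bilinear_isBilinear.Build F
  (A * A)%type (A * A)%type (A * A)%type _ _ sq_mul sq_mul_bilinear.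

Definition nalg_sq : nalg F := @NAlg F (A * A)%type sq_mul.

(** The projections are homomorphisms, so evaluation is coordinatewise; this is what keeps the
    square of [A] in the variety. *)
Lemma peval_sq (e : nat -> nalg_sq) v :
  peval e v = (peval (fst \o e) v, peval (snd \o e) v).
Proof.
have mE m : meval e m = (meval (fst \o e) m, meval (snd \o e) m).
  by elim: m => /= [i|m1 -> m2 ->] //; case: (e i).
rewrite /peval; elim: v => [|cm v IH]; first by rewrite !big_nil.
by rewrite !big_cons IH mE.
Qed.

Lemma satisfies_sq v : satisfies A v -> satisfies nalg_sq v.
Proof. by move=> Av e; rewrite peval_sq !Av. Qed.

Definition sq_diag : set nalg_sq := [set z | z.1 = z.2].

Lemma sq_diag_subalgebra : subalgebra sq_diag.
Proof.
split; last by move=> [x x'] [y y']; rewrite /sq_diag /= => -> ->.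
by apply/subspaceP; split=> // a [x x'] [y y']; rewrite /sq_diag /= => -> ->.
Qed.

Lemma sq_diag_subideal_nilpotent : subideal sq_diag -> nilpotent_nalg A.
Proof.
move=> [s [C [C0 Cs _ Cid]]].
(* The series increases from the diagonal, so each of its terms contains the diagonal. *)
have diagC i b : (i <= s)%N -> C i (b, b).
  elim: i => [|i IH] si; first by rewrite C0.
  by have [_ sub _] := Cid i si; apply: sub; apply: IH; exact: ltnW.
have Csub i : (i <= s)%N -> subspace (C i).
  by rewrite leq_eqVlt => /predU1P[->|/Cid[]//]; rewrite Cs; exact: subspaceT.
(* The guard makes [D k] everything for [k > s], so the closure conditions, required for all [k],
   hold trivially there. *)
pose D k : set A := [set x | (k <= s)%N -> C (s - k)%N (x, 0)].
(* [D s] is zero, as [(x, 0)] is diagonal only for [x = 0]. The exponent exceeds [2 ^ s] by one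
   because the class must be at least 1, also when [s = 0]. *)
suff DE : npow (2 ^ s).+1 `<=` D s.
  apply: (npow_zero_nilpotent (c := 2 ^ s)); first by rewrite expn_gt0.
  by move=> x /DE /(_ (leqnn s)); rewrite subnn C0.
apply: npow_exp2_sub => //.
- by apply/seteqP; split=> // x _ _; rewrite subn0 Cs.
- move=> k; apply/subspaceP.
  have [ks|sk] := leqP k s; last first.
    by split=> [|a x y _ _]; rewrite /D /= leqNgt sk.
  have /subspaceP[C00 CP] := Csub _ (leq_subr k s).
  split=> [_|a x y /(_ ks) Cx /(_ ks) Cy _] //.
  have -> : (a *: x + y, 0) = a *: (x, 0) + (y, 0) :> nalg_sq.
    by congr pair; rewrite /= scaler0 addr0.
  exact: CP.
- move=> k x y Dx.
  suff H : (k < s)%N ->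
    C (s - k.+1)%N (nmul A x y, 0) /\ C (s - k.+1)%N (nmul A y x, 0).
    by split=> ks; have [] := H ks.
  move=> ks; have sk1 : (s - k.+1 < s)%N by rewrite ltn_subrL (leq_trans _ ks).
  have [_ _ CM] := Cid _ sk1; rewrite -subSn // subSS in CM.
  (* The diagonal element [(y, y)] lies in the ideal [C (s - k.+1)] of [C (s - k)], which contains
     [(x, 0)]; both products have second coordinate 0. *)
  have [] := CM (y, y) (x, 0) (diagC _ _ (ltnW sk1)) (Dx (ltnW ks)).
  by rewrite /= /sq_mul /= linear0l linear0r.
Qed.

End Square.

Theorem theorem1 (F : fieldType) (V : nalg F -> Prop) (hV : variety V) :
  nilpotent_variety V <->
  (forall A : nalg F, V A -> forall B : set A, subalgebra B -> subideal B).
Proof.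
split=> [Vnil A VA B|Vsub A VA]; first exact/nilpotent_subideal/Vnil.
apply/sq_diag_subideal_nilpotent/Vsub; last exact: sq_diag_subalgebra.
have [E VE] := hV; apply/VE => v Ev.
by apply: satisfies_sq; exact: (VE A).1.
Qed.
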